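(* For an integer $q\ge 1$, let $L(q)$ be the minimum, over all infinite 2D words $w$ with $|Alph(w)|=q$, of the number of distinct non-empty HV-palindromic factors of $w$. Then $L(1)=\infty$, $L(2)=14$, and $L(q)=q$ for every $q\ge 3$.
   Context: An infinite 2D word over a finite alphabet $\Sigma$ is an array $w=[w_{i,j}]_{i,j\ge 1}$ with entries in $\Sigma$ (infinitely many rows and columns). $Alph(w)$ is the set of letters occurring in $w$. A factor of $w$ is a finite sub-array $[w_{i,j}]_{a\le i\le b,\,c\le j\le d}$ of consecutive rows and columns, considered as a finite 2D word; factors are counted as distinct arrays, independently of their positions. A 1D word is a palindrome if it equals its reversal, and a finite 2D word is an HV-palindrome if each of its rows and each of its columns is a 1D palindrome. *)

(* Defs.v *)
From mathcomp Require Import all_boot all_order all_algebra.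
From mathcomp Require Import finmap.
From mathcomp Require Import boolp classical_sets functions cardinality.
From mathcomp Require Import constructive_ereal.

Set Implicit Arguments.
Unset Strict Implicit.
Unset Printing Implicit Defensive.

Import Order.TTheory GRing.Theory Num.Theory.
Local Open Scope ereal_scope.
Local Open Scope ring_scope.
Local Open Scope classical_set_scope.

(* Infinite 2D words [w i j]; rows [i] and columns [j] are indexed from 0
   instead of 1. *)
Definition iword2 (S : finType) := nat -> nat -> S.

(* Finite 2D words of all sizes; the size is part of the word, so that words
   of different sizes are distinct. *)
Definition fword2 (S : finType) := {mn : nat * nat & 'M[S]_(mn.1, mn.2)}.

Section Words.
Variable S : finType.
Implicit Types (w : iword2 S) (u : fword2 S).

Definition fword2_of (m n : nat) (A : 'M[S]_(m, n)) : fword2 S :=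
  existT (fun mn : nat * nat => 'M[S]_(mn.1, mn.2)) (m, n) A.

Definition Alph w : set S := [set x | exists i j, w i j = x].

(* The sub-array with [m] rows and [n] columns whose top left entry is
   [w a c]. *)
Definition block w (a c m n : nat) : 'M[S]_(m, n) :=
  \matrix_(i < m, j < n) w (a + i)%N (c + j)%N.

Definition factor w u : Prop :=
  exists a c m n : nat, u = fword2_of (block w a c m n).

Definition nonempty u : Prop := (0 < (tag u).1)%N /\ (0 < (tag u).2)%N.

Definition palindrome (s : seq S) : Prop := rev s = s.

Definition HVpalindrome u : Prop :=
  (forall i, palindrome [seq tagged u i j | j <- enum 'I_(tag u).2]) /\
  (forall j, palindrome [seq tagged u i j | i <- enum 'I_(tag u).1]).

Definition HVpal_factors w : set (fword2 S) :=
  [set u | [/\ factor w u, nonempty u & HVpalindrome u]].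

End Words.

(* Number of elements of a set, [+oo] when it is infinite. *)
Definition ecard (T : choiceType) (A : set T) : \bar int :=
  if `[< finite_set A >] then (#|` fset_set A|%:Z)%:E else +oo%E.

(* All the values taken by the number of distinct non-empty HV-palindromic
   factors, over infinite 2D words with exactly [q] letters. *)
Definition HVpal_counts (q : nat) : set (\bar int) :=
  [set v | exists (S : finType) (w : iword2 S),
     ecard (Alph w) = (q%:Z)%:E /\ ecard (HVpal_factors w) = v].

Definition is_minimum d (T : porderType d) (A : set T) (v : T) : Prop :=
  A v /\ lbound A v.

(* [is_L q v]: the quantity L(q) is well-defined and equal to [v]. *)
Definition is_L (q : nat) (v : \bar int) : Prop :=
  is_minimum (HVpal_counts q) v.

(* Main.v *)
(** A 1D palindrome occurring in a row (or a column) is an HV-palindrome with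
    one row (column). Any 9 consecutive letters of a binary word contain at
    least 6 palindromes of length at least 2, so a binary 2D word has at least
    2 + 6 + 6 HV-palindromic factors. Equality holds for [w i j = x (i + j)]
    with [x = (001011)^omega], whose palindromes have length at most 4 and
    which yields no HV-palindrome with at least two rows and two columns. For
    [q >= 3] letters, [w i j = (i + j) mod q] has no palindrome of length 2
    or 3 in its rows and columns, hence none longer than a letter. *)

Require Import Defs.
From mathcomp Require Import all_boot all_order all_algebra.
From mathcomp Require Import constructive_ereal.
From mathcomp Require Import finmap boolp classical_sets cardinality.
From mathcomp Require Import zify.

Set Implicit Arguments.
Unset Strict Implicit.
Unset Printing Implicit Defensive.

Import Order.TTheory GRing.Theory Num.Theory.

(** * Counting elements of possibly infinite sets *)

Lemma ecard_seqP (T : choiceType) (A : set T) (n : nat) :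
  ecard A = (n%:Z)%:E%E -> exists s : seq T,
    [/\ uniq s, size s = n & forall x, A x <-> x \in s].
Proof.
rewrite /ecard; case: asboolP => // fA [card_A].
exists (enum_fset (fset_set A)); split => //.
by move=> x; rewrite in_fset_set // in_setE.
Qed.

(** An image never has more elements than its source, so lower bounds come from distinct images. *)
Lemma ecard_ge (T : choiceType) (U : eqType) (A : set T) (f : T -> U)
    (s : seq U) :
  uniq s -> (forall y, y \in s -> exists2 x, A x & f x = y) ->
  (((size s)%:Z)%:E <= ecard A)%E.
Proof.
move=> s_uniq sA; rewrite /ecard; case: asboolP => [fA|_]; last exact: leey.
rewrite lee_fin lez_nat -(size_map f (enum_fset (fset_set A))).
apply: uniq_leq_size => // y /sA[x Ax <-]; apply: map_f.
by rewrite in_fset_set // in_setE.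
Qed.

Lemma ecard_pinfty (T : choiceType) (A : set T) :
  (forall n : nat, ((n%:Z)%:E <= ecard A)%E) -> ecard A = +oo%E.
Proof.
rewrite /ecard; case: asboolP => // fA /(_ #|` fset_set A|.+1).
by rewrite lee_fin lez_nat ltnn.
Qed.

Lemma ecard_eq (T U : choiceType) (A : set T) (f : T -> U) (s : seq U) :
  uniq s -> {in A &, injective f} ->
  (forall y, y \in s <-> exists2 x, A x & f x = y) ->
  ecard A = ((size s)%:Z)%:E%E.
Proof.
move=> s_uniq f_inj sP.
have fAs : (f @` A)%classic = [set` s]%classic.
  by apply/seteqP; split=> y /=; [move=> yA; apply/sP | move/sP].
have fA : finite_set A.
  rewrite -(eq_finite_set (inj_card_eq f_inj)) fAs; exact: finite_seq.
apply/eqP; rewrite eq_le (ecard_ge (f := f)) // ?andbT; last by move=> y /sP.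
rewrite /ecard asboolT // lee_fin lez_nat -(size_map f (enum_fset _)).
apply: uniq_leq_size => [|y /mapP[x]].
  rewrite map_inj_in_uniq ?fset_uniq // => x y.
  by rewrite !in_fset_set //; apply: f_inj.
by rewrite in_fset_set // in_setE => Ax ->; apply/sP; exists x.
Qed.

(** * HV-palindromic factors as sequences of rows *)

Section Rows.
Variable S : finType.
Implicit Types (w : iword2 S) (u : fword2 S).

(* The size of a word without rows or columns cannot be read off [rows]. *)
Definition rows u : seq (seq S) :=
  [seq [seq tagged u i j | j <- enum 'I_(tag u).2] | i <- enum 'I_(tag u).1].

Lemma map_enum_ord (T : Type) (n : nat) (f : nat -> T) :
  [seq f i | i : 'I_n <- enum 'I_n] = mkseq f n.
Proof. by rewrite /mkseq -val_enum_ord -map_comp. Qed.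

Lemma rows_block w a c m n :
  rows (fword2_of (block w a c m n)) =
  mkseq (fun i => mkseq (fun j => w (a + i) (c + j)) n) m.
Proof.
rewrite -map_enum_ord; apply: eq_map => i /=.
rewrite -map_enum_ord; apply: eq_map => j /=.
by rewrite mxE.
Qed.

Lemma rows_inj : {in [set u | Defs.nonempty u]%classic &, injective rows}.
Proof.
move=> [[m n] A] [[m' n'] B].
rewrite !in_setE /Defs.nonempty /= => -[m_gt0 n_gt0] _.
rewrite /rows /= => eqAB.
have eqm : m = m'.
  by have := congr1 size eqAB; rewrite !(size_enum_ord, size_map).
subst m'.
have eq_row i : [seq A i j | j <- enum 'I_n] = [seq B i j | j <- enum 'I_n'].
  by move/eq_in_map: eqAB => /(_ i) -> //; rewrite mem_enum.
(* The number of columns is read off the first row, which exists by [m_gt0]. *)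
have eqn : n = n'.
  have := congr1 size (eq_row (Ordinal m_gt0)).
  by rewrite !(size_enum_ord, size_map).
subst n'; suff -> : A = B by [].
apply/matrixP => i j.
by move/eq_in_map: (eq_row i) => /(_ j) -> //; rewrite mem_enum.
Qed.

Lemma HVpal_block w a c m n :
  HVpalindrome (fword2_of (block w a c m n)) <->
  (forall i, i < m -> palindrome (mkseq (fun j => w (a + i) (c + j)) n)) /\
  (forall j, j < n -> palindrome (mkseq (fun i => w (a + i) (c + j)) m)).
Proof.
have rowE (i : 'I_m) : [seq block w a c m n i j | j <- enum 'I_n] =
    mkseq (fun j => w (a + i) (c + j)) n.
  by rewrite -map_enum_ord; apply: eq_map => j; rewrite mxE.
have colE (j : 'I_n) : [seq block w a c m n i j | i <- enum 'I_m] =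
    mkseq (fun i => w (a + i) (c + j)) m.
  by rewrite -map_enum_ord; apply: eq_map => i; rewrite mxE.
split=> -[rowP colP]; split.
- by move=> i im; rewrite -(rowE (Ordinal im)); apply: rowP.
- by move=> j jn; rewrite -(colE (Ordinal jn)); apply: colP.
- by move=> i; rewrite rowE; apply: rowP.
- by move=> j; rewrite colE; apply: colP.
Qed.

(** The columns of a one-row factor have length 1, so only its row has to be a palindrome. *)
Lemma row_HVpal w a c n : 0 < n ->
  palindrome (mkseq (fun j => w a (c + j)) n) ->
  exists2 u, HVpal_factors w u & rows u = [:: mkseq (fun j => w a (c + j)) n].
Proof.
move=> n_gt0 pal; exists (fword2_of (block w a c 1 n)); last first.
  by rewrite rows_block /mkseq /= addn0.
split=> //; first by exists a, c, 1%N, n.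
apply/HVpal_block; split=> // i; rewrite ltnS leqn0 => /eqP ->.
by rewrite addn0.
Qed.

Lemma col_HVpal w a c n : 0 < n ->
  palindrome (mkseq (fun i => w (a + i) c) n) ->
  exists2 u, HVpal_factors w u &
    rows u = [seq [:: x] | x <- mkseq (fun i => w (a + i) c) n].
Proof.
move=> n_gt0 pal; exists (fword2_of (block w a c n 1)); last first.
  by rewrite rows_block /mkseq -map_comp; apply: eq_map => i /=; rewrite addn0.
split=> //; first by exists a, c, n, 1%N.
apply/HVpal_block; split=> // j; rewrite ltnS leqn0 => /eqP ->.
by rewrite addn0.
Qed.

Lemma letter_HVpal w x : Alph w x ->
  exists2 u, HVpal_factors w u & rows u = [:: [:: x]].
Proof.
move=> [a [c <-]]; have := @row_HVpal w a c 1 isT.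
by rewrite /mkseq /= addn0; apply.
Qed.

(** Each letter is a 1 by 1 HV-palindrome. This is the lower bound for [q >= 3]. *)
Lemma ecard_HVpal_ge_Alph w q :
  ecard (Alph w) = (q%:Z)%:E%E -> ((q%:Z)%:E <= ecard (HVpal_factors w))%E.
Proof.
move=> /ecard_seqP[s [s_uniq <- sP]].
rewrite -(size_map (fun x => [:: [:: x]]) s); apply: (ecard_ge (f := rows)).
  by rewrite map_inj_uniq // => x y [].
by move=> y /mapP[x /sP xw ->]; apply: letter_HVpal.
Qed.

End Rows.

(** * One letter: constant words *)

Lemma ecard_HVpal_1 (S : finType) (w : iword2 S) :
  ecard (Alph w) = (1%:Z)%:E%E -> ecard (HVpal_factors w) = +oo%E.
Proof.
move=> /ecard_seqP[s [_ size_s sP]].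
case: s size_s sP => [//|x [|//]] _ sP.
have wx i j : w i j = x.
  by apply/eqP; rewrite -mem_seq1; apply/sP; exists i, j.
apply: ecard_pinfty => n.
pose f k := [:: nseq k.+1 x].
have size_f : size (mkseq f n) = n by rewrite size_mkseq.
rewrite -size_f; apply: (ecard_ge (f := @rows S)).
  apply: mkseq_uniq => i j [] /(congr1 size).
  by rewrite !size_nseq.
move=> y /mapP[k _ ->]; rewrite /f.
have rowE : mkseq (fun j => w 0 (0 + j)) k.+1 = nseq k.+1 x.
  by apply: (@eq_from_nth _ x) => [|i]; rewrite size_mkseq ?size_nseq // => ik;
    rewrite nth_mkseq // nth_nseq ik.
by rewrite -rowE; apply: row_HVpal => //; rewrite rowE /palindrome rev_nseq.
Qed.

(** * Two letters: the lower bound *)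

Section LongPalindromes.
Variable T : finType.
Implicit Types t p : seq T.

(** Written as a program, to be evaluated on concrete words. Near the end of [t], [take] truncates;
    the result is still a factor of [t], and [undup] removes the repetitions. *)
Definition long_pals t : seq (seq T) :=
  undup [seq p <- [seq take n (drop c t) |
                    c <- iota 0 (size t), n <- iota 2 (size t)] |
          (1 < size p) && (rev p == p)].

Lemma long_pals_mkseq (r : nat -> T) n p : p \in long_pals (mkseq r n) ->
  exists c, let m := size p in
    [/\ 1 < m, p = mkseq (fun j => r (c + j)) m & palindrome p].
Proof.
rewrite mem_undup mem_filter => /andP[/andP[p_gt1 /eqP p_pal]].
case/allpairsP => -[c m] /= [_ _ pE]; exists c; split=> //.
apply: (@eq_from_nth _ (r 0)) => [|i i_p]; first by rewrite size_mkseq.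
rewrite nth_mkseq // {1}pE.
move: i_p; rewrite pE size_take_min size_drop size_mkseq leq_min.
move=> /andP[im ic].
by rewrite nth_take // nth_drop nth_mkseq // -ltn_subRL.
Qed.

End LongPalindromes.

(** Exhaustive evaluation over the 512 binary words of length 9. *)
Lemma long_pals_bool (b0 b1 b2 b3 b4 b5 b6 b7 b8 : bool) :
  6 <= size (long_pals [:: b0; b1; b2; b3; b4; b5; b6; b7; b8]).
Proof. by move: b0 b1 b2 b3 b4 b5 b6 b7 b8; do 9! case; vm_compute. Qed.

(** The test [r i == a] encodes [r] as a boolean word. The decoding [f] is injective, so it keeps
    palindromes distinct and the computation on booleans carries over to [S]. *)
Lemma binary_long_pals (S : finType) (a b : S) (r : nat -> S) :
  a != b -> (forall i, r i \in [:: a; b]) -> exists ps : seq (seq S),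
    [/\ uniq ps, 6 <= size ps & forall p, p \in ps -> exists c,
      let m := size p in
      [/\ 1 < m, p = mkseq (fun j => r (c + j)) m & palindrome p]].
Proof.
move=> neq_ab rab; pose f := fun t : bool => if t then a else b.
have f_inj : injective f.
  by move=> [] [] //= eqab; move: neq_ab; rewrite eqab eqxx.
have fK i : f (r i == a) = r i.
  by move: (rab i); rewrite !inE /f; case: eqP => [->|_] //= /eqP.
exists [seq map f p | p <- long_pals (mkseq (fun i => r i == a) 9)].
split.
- by rewrite map_inj_uniq ?undup_uniq //; apply: inj_map.
- by rewrite size_map; apply: long_pals_bool.
move=> p /mapP[t /long_pals_mkseq[c [t_gt1 tE t_pal]] ->].
exists c; rewrite /= size_map; split=> //; last first.
  by rewrite /palindrome -map_rev t_pal.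
by rewrite {1}tE -map_comp; apply: eq_map => i /=; rewrite fK.
Qed.

Lemma ecard_HVpal_2 (S : finType) (w : iword2 S) :
  ecard (Alph w) = (2%:Z)%:E%E -> ((14%:Z)%:E <= ecard (HVpal_factors w))%E.
Proof.
move=> /ecard_seqP[s [s_uniq size_s sP]].
case: s size_s s_uniq sP => [//|a [//|b [|//]]] _ /=.
rewrite inE andbT => neq_ab sP.
have wab i j : w i j \in [:: a; b] by apply/sP; exists i, j.
(* Row 0 and column 0 each supply six palindromes. *)
have [ps [ps_uniq size_ps psP]] := binary_long_pals neq_ab (wab 0).
have [qs [qs_uniq size_qs qsP]] :=
  binary_long_pals neq_ab (fun i => wab i 0).
pose L := [seq [:: [:: x]] | x <- [:: a; b]] ++ [seq [:: p] | p <- ps] ++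
  [seq [seq [:: x] | x <- q] | q <- qs].
apply: (@le_trans _ _ ((size L)%:Z)%:E%E).
  by rewrite lee_fin lez_nat !size_cat !size_map /=; lia.
apply: (ecard_ge (f := @rows S)).
  rewrite !cat_uniq !map_inj_uniq //=; first last.
  - by move=> x y [].
  - by move=> x y [].
  - by apply: inj_map => x y [].
  rewrite inE andbT neq_ab ps_uniq qs_uniq /= andbT.
  (* The three families are disjoint by shape: a single cell, one row with at least two columns, one
     column with at least two rows. *)
  apply/andP; split; apply/hasPn => y.
    rewrite mem_cat => /orP[] /mapP[p].
      move=> /psP[c [p_gt1 _ _]] ->; rewrite !inE.
      by apply/negP => /orP[] /eqP[pE]; rewrite pE in p_gt1.
    move=> /qsP[c [p_gt1 _ _]] ->; rewrite !inE.
    by apply/negP => /orP[] /eqP /(congr1 size); rewrite size_map /= => pE;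
      rewrite pE in p_gt1.
  move=> /mapP[q /qsP[c [q_gt1 _ _]] ->].
  apply/negP => /mapP[p _] /(congr1 size); rewrite size_map /= => pE.
  by rewrite pE in q_gt1.
move=> y; rewrite mem_cat => /orP[/mapP[x /sP xw ->]|].
  exact: letter_HVpal.
rewrite mem_cat => /orP[] /mapP[p].
  move=> /psP[c [p_gt1 pE p_pal]] ->; rewrite pE.
  by apply: row_HVpal; rewrite -?pE //; apply: ltnW.
move=> /qsP[c [p_gt1 pE p_pal]] ->; rewrite pE.
by apply: col_HVpal; rewrite -?pE //; apply: ltnW.
Qed.

(** * Two letters: a periodic word with 14 HV-palindromes *)

Lemma palindrome_mkseq (T : finType) (f : nat -> T) n i :
  palindrome (mkseq f n) -> i < n -> f (n - i.+1) = f i.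
Proof.
move=> pal i_n; have := congr1 (fun s => nth (f 0) s i) pal.
rewrite /= nth_rev size_mkseq // !nth_mkseq //; lia.
Qed.

Definition periodic_letter (k : nat) : bool :=
  nth false [:: false; false; true; false; true; true] (k %% 6).

Definition periodic_word : iword2 bool := fun i j => periodic_letter (i + j).

Lemma periodic_letter_mod k i :
  periodic_letter (k %% 6 + i) = periodic_letter (k + i).
Proof. by rewrite /periodic_letter modnDml. Qed.

(** In a palindrome of length [n >= 5], the letters at [j] and [n - 1 - j = (n - 5) + (4 - j)] agree
    for every [j < 5]. Since [k] and [d = n - 5] matter only modulo 6, it is enough to find a
    mismatch in each of 36 cases. *)
Lemma periodic_letter_pal k n :
  palindrome (mkseq (fun j => periodic_letter (k + j)) n) -> n <= 4.
Proof.
move=> pal; rewrite leqNgt; apply/negP => n_gt4.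
have no_sym : all (fun k => all (fun d => has (fun j =>
    periodic_letter (d + (k + (4 - j))) != periodic_letter (k + j))
    (iota 0 5)) (iota 0 6)) (iota 0 6) by [].
have mem6 m : m %% 6 \in iota 0 6 by rewrite mem_iota /= ltn_mod.
move/allP: no_sym => /(_ _ (mem6 k)) /allP /(_ _ (mem6 (n - 5))) /hasP[j].
rewrite mem_iota /= => j5.
rewrite periodic_letter_mod addnCA !periodic_letter_mod => /eqP; apply.
rewrite -(palindrome_mkseq pal); last lia.
congr periodic_letter; lia.
Qed.

Definition periodic_rows (k m n : nat) : seq (seq bool) :=
  mkseq (fun i => mkseq (fun j => periodic_letter (k + (i + j))) n) m.

(* [periodic_word] is symmetric, so the columns of one of its [m * n] factors
   are the rows of an [n * m] factor. *)
Definition periodic_HVpal (k m n : nat) : bool :=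
  all (fun p => rev p == p) (periodic_rows k m n) &&
  all (fun p => rev p == p) (periodic_rows k n m).

(** Letters depend only on the sum of the coordinates, so a factor depends on its corner only
    through [a + c] modulo 6. This leaves six starting phases to examine. *)
Lemma rows_periodic a c m n :
  rows (fword2_of (block periodic_word a c m n)) =
  periodic_rows ((a + c) %% 6) m n.
Proof.
rewrite rows_block; apply: eq_map => i; apply: eq_map => j.
by rewrite periodic_letter_mod addnACA.
Qed.

Lemma HVpal_periodic a c m n :
  HVpalindrome (fword2_of (block periodic_word a c m n)) <->
  periodic_HVpal ((a + c) %% 6) m n.
Proof.
have rowE i j : periodic_letter ((a + c) %% 6 + (i + j)) =
    periodic_word (a + i) (c + j).
  by rewrite periodic_letter_mod addnACA.
have colE j i : periodic_letter ((a + c) %% 6 + (j + i)) =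
    periodic_word (a + i) (c + j).
  by rewrite (addnC j) rowE.
split=> [/HVpal_block[rowP colP]|/andP[/allP rowP /allP colP]].
  apply/andP; split; apply/allP => p /mapP[i]; rewrite mem_iota /= => im ->;
    apply/eqP.
    by rewrite (eq_mkseq (rowE i)); apply: rowP.
  by rewrite (eq_mkseq (colE i)); apply: colP.
apply/HVpal_block; split=> i im; apply/eqP.
  by rewrite -(eq_mkseq (rowE i)); apply: rowP; apply: map_f; rewrite mem_iota.
by rewrite -(eq_mkseq (colE i)); apply: colP; apply: map_f; rewrite mem_iota.
Qed.

Definition periodic_HVpals : seq (seq (seq bool)) :=
  let long_pals := [:: [:: false; false]; [:: true; true];
    [:: false; true; false]; [:: true; false; true];
    [:: false; true; true; false]; [:: true; false; false; true]] in
  [:: [:: [:: false]]; [:: [:: true]]] ++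
  [seq [:: p] | p <- long_pals] ++ [seq [seq [:: x] | x <- p] | p <- long_pals].

(** Two finite checks, on sides at most 4 as allowed by [periodic_letter_pal]: every HV-palindrome
    found is in the list, and every member of the list occurs. *)
Lemma periodic_HVpalsP :
  all (fun k => all (fun m => all (fun n =>
    periodic_HVpal k m n ==> (periodic_rows k m n \in periodic_HVpals))
    (iota 1 4)) (iota 1 4)) (iota 0 6) /\
  all (fun y => has (fun k => has (fun m => has (fun n =>
    periodic_HVpal k m n && (periodic_rows k m n == y))
    (iota 1 4)) (iota 1 4)) (iota 0 6)) periodic_HVpals.
Proof. by split; vm_compute. Qed.

Lemma ecard_Alph_periodic : ecard (Alph periodic_word) = (2%:Z)%:E%E.
Proof.
apply: (@ecard_eq _ _ _ id [:: false; true]) => // -[]; split=> // _.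
  by exists true => //; exists 0%N, 2%N.
by exists false => //; exists 0%N, 0%N.
Qed.

Lemma ecard_HVpal_periodic :
  ecard (HVpal_factors periodic_word) = (14%:Z)%:E%E.
Proof.
have [/allP sub /allP sup] := periodic_HVpalsP.
apply: (@ecard_eq _ _ _ (@rows bool) periodic_HVpals) => //.
  move=> u v; rewrite !in_setE => -[_ u0 _] [_ v0 _].
  by apply: rows_inj; rewrite in_setE.
move=> y; split=> [/sup/hasP[k]|[_ [[a [c [m [n ->]]]] [/= m_gt0 n_gt0]]]].
  rewrite mem_iota add0n => k6 /hasP[m]; rewrite mem_iota => /andP[m_gt0 _].
  case/hasP=> n; rewrite mem_iota => /andP[n_gt0 _] /andP[pal /eqP <-].
  (* The corner at row 0 and column [k] realises the phase [k]. *)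
  exists (fword2_of (block periodic_word 0 k m n)).
    split=> //; first by exists 0%N, k, m, n.
    by apply/HVpal_periodic; rewrite add0n modn_small.
  by rewrite rows_periodic add0n modn_small.
move=> pal <-; rewrite rows_periodic.
have [rowP colP] := (HVpal_block _ _ _ _ _).1 pal.
(* The first row and the first column are palindromes of the periodic word, which bounds both
   sides. *)
have n4 : n <= 4.
  apply: (@periodic_letter_pal (a + 0 + c)).
  by rewrite -(eq_mkseq (fun j => congr1 _ (addnA (a + 0) c j))); apply: rowP.
have m4 : m <= 4.
  apply: (@periodic_letter_pal (a + (c + 0))).
  by rewrite -(eq_mkseq (fun j => congr1 _ (addnAC a j (c + 0)))); apply: colP.
have k6 : (a + c) %% 6 \in iota 0 6 by rewrite mem_iota /= ltn_mod.
have m14 : m \in iota 1 4 by rewrite mem_iota m_gt0.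
have n14 : n \in iota 1 4 by rewrite mem_iota n_gt0.
move: (sub _ k6) => /allP /(_ _ m14) /allP /(_ _ n14) /implyP; apply.
exact/HVpal_periodic.
Qed.

(** * At least three letters: the cyclic word *)

(** Writing the alphabet size as [q.+3] builds in the bound of three letters and makes the ordinal
    type inhabited, as [inord] requires. *)
Definition cyclic_letter (q k : nat) : 'I_q.+3 := inord (k %% q.+3).

Definition cyclic_word (q : nat) : iword2 'I_q.+3 :=
  fun i j => cyclic_letter q (i + j).

Lemma cyclic_letter_eq q k d :
  cyclic_letter q k = cyclic_letter q (k + d) -> q.+3 %| d.
Proof.
move=> /(congr1 val); rewrite /= !inordK ?ltn_mod // => kd.
have : k == k + d %[mod q.+3] by rewrite kd.
by rewrite eq_sym eqn_mod_dvd ?leq_addr // addKn.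
Qed.

(* A palindrome of length at least 2 has equal letters at distance 1 or 2
   around its centre. *)
Lemma cyclic_letter_pal q k n :
  palindrome (mkseq (fun j => cyclic_letter q (k + j)) n) -> n <= 1.
Proof.
move=> pal; rewrite leqNgt; apply/negP => n_gt1.
(* The index [(n./2).-1] lies just left of the centre; its mirror image is at distance [e = 1] if
   [n] is even and [e = 2] if [n] is odd. *)
have i_n : (n./2).-1 < n by lia.
have [e nE e_gt0] : exists2 e, n - (n./2).-1.+1 = (n./2).-1 + e & 0 < e < 3.
  by exists (n - (n./2).-1.+1 - (n./2).-1); lia.
have := palindrome_mkseq pal i_n; rewrite nE addnA => /esym/cyclic_letter_eq.
by move=> /dvdn_leq; lia.
Qed.

Lemma ecard_Alph_cyclic q :
  ecard (Alph (cyclic_word q)) = (q.+3%:Z)%:E%E.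
Proof.
rewrite -[in RHS](size_enum_ord q.+3).
apply: (@ecard_eq _ _ _ id) => // [|y]; first exact: enum_uniq.
split=> [_|]; last by rewrite mem_enum.
exists y => //; exists 0%N, (nat_of_ord y).
by rewrite /cyclic_word /cyclic_letter add0n modn_small // inord_val.
Qed.

Lemma ecard_HVpal_cyclic q :
  ecard (HVpal_factors (cyclic_word q)) = (q.+3%:Z)%:E%E.
Proof.
rewrite -[in RHS](size_enum_ord q.+3) -(size_map (fun x => [:: [:: x]])).
apply: (@ecard_eq _ _ _ (@rows _)) => [|u v|y].
- by rewrite map_inj_uniq ?enum_uniq // => x y [].
- rewrite !in_setE => -[_ u0 _] [_ v0 _].
  by apply: rows_inj; rewrite in_setE.
split=> [/mapP[x _ ->]|[_ [[a [c [m [n ->]]]] [/= m_gt0 n_gt0]]]].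
  apply: letter_HVpal; exists 0%N, (nat_of_ord x).
  by rewrite /cyclic_word /cyclic_letter add0n modn_small // inord_val.
move=> /HVpal_block[rowP colP] <-.
(* The first row and the first column force the factor to be a single letter. *)
have n1 : n <= 1.
  apply: (@cyclic_letter_pal q (a + 0 + c)).
  by rewrite -(eq_mkseq (fun j => congr1 _ (addnA (a + 0) c j))); apply: rowP.
have m1 : m <= 1.
  apply: (@cyclic_letter_pal q (a + (c + 0))).
  by rewrite -(eq_mkseq (fun j => congr1 _ (addnAC a j (c + 0)))); apply: colP.
have -> : m = 1%N by lia.
have -> : n = 1%N by lia.
by rewrite rows_block; apply: map_f; rewrite mem_enum.
Qed.

(** * The values of L(q) *)

Theorem theorem5p12 :
  [/\ is_L 1 +oo%E,
      is_L 2 (14%:Z)%:E%E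
    & forall q : nat, 3 <= q -> is_L q (q%:Z)%:E%E].
Proof.
split=> [||[|[|[|q]]] // _]; split.
(* The value [+oo] must also be attained, so a one-letter word has to be exhibited. *)
- have card1 : ecard (Alph (fun _ _ : nat => tt)) = (1%:Z)%:E%E.
    apply: (@ecard_eq _ _ _ id [:: tt]) => // -[]; split=> // _.
    by exists tt => //; exists 0%N, 0%N.
  by exists unit, (fun _ _ => tt); split=> //; apply: ecard_HVpal_1.
- by move=> _ [S [w [/ecard_HVpal_1 w_oo <-]]]; rewrite w_oo.
- exists bool, periodic_word.
  by split; [apply: ecard_Alph_periodic | apply: ecard_HVpal_periodic].
- by move=> _ [S [w [w2 <-]]]; apply: ecard_HVpal_2.
- exists 'I_q.+3, (cyclic_word q).
  by split; [apply: ecard_Alph_cyclic | apply: ecard_HVpal_cyclic].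
- by move=> _ [S [w [wq <-]]]; apply: ecard_HVpal_ge_Alph.
Qed.
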